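(* Let $a=1$ and $b=-\beta^2$ with $\beta\in\mathbb R$, $\beta\neq0$, and consider the classical metric $g$ on the region $r>0$, $0<\theta<\pi$, in coordinates $(t,r,\theta,\phi)$, $$g=b\,r^2\,\mathrm dt^2-2b\,r\,t\,\mathrm dr\,\mathrm dt+(a+b\,t^2)\,\mathrm dr^2+r^2(\mathrm d\theta^2+\sin^2\theta\,\mathrm d\phi^2).$$ Let $u=(1/(\beta r),0,0,0)$. Then $g_{ij}u^iu^j=-1$ and the Einstein tensor satisfies $$G^{ij}=\frac{4}{r^2}g^{ij}+\frac{4}{r^2}u^iu^j .$$ Hence $G^{ij}=8\pi G_N T^{ij}$ where $T^{ij}=p\,g^{ij}+(p+\rho)u^iu^j$ is the stress tensor of a perfect fluid with pressure $p=\dfrac{1}{2\pi G_N r^2}$ and density $\rho=0$.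
   Context: $G_{ij}=R_{ij}-\tfrac12 S g_{ij}$ is the usual Einstein tensor of the Levi-Civita connection (signature $-+++$, sign conventions such that the round sphere has positive Ricci curvature), $G^{ij}$ is obtained by raising indices with $g$, and $G_N>0$ is the gravitational constant (units with speed of light 1). $T^{ij}=p\,g^{ij}+(p+\rho)u^iu^j$ is the perfect fluid stress-energy tensor with normalised 4-velocity $u$, pressure $p$, energy density $\rho$. *)

(* Defs.v *)
From HB Require Import structures.
From mathcomp Require Import all_boot all_order all_algebra.
From mathcomp Require Import all_classical all_reals all_analysis.

Set Implicit Arguments.
Unset Strict Implicit.
Unset Printing Implicit Defensive.

Import Order.TTheory GRing.Theory Num.Theory.
Import numFieldNormedType.Exports.

Local Open Scope ring_scope.

(* Tensor calculus in a single coordinate chart: a point is the row vector of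
   its n coordinates and a tensor field is given by its component functions,
   defined on all of R^n. Every construction below only uses the germ of the
   metric at the point, so components may be arbitrary away from the open
   region of interest. *)

(* \partial_k f *)
Definition partial (R : realType) (n : nat) (k : 'I_n) (f : 'rV[R]_n -> R)
    (x : 'rV[R]_n) : R :=
  'D_(delta_mx 0 k) f x.

(* g^{ij} *)
Definition inv_metric (R : realType) (n : nat) (g : 'rV[R]_n -> 'M[R]_n)
    (x : 'rV[R]_n) : 'M[R]_n :=
  invmx (g x).

(* Levi-Civita connection:
   Gamma^k_{ij} = 1/2 g^{kl} (d_i g_{jl} + d_j g_{il} - d_l g_{ij}) *)
Definition christoffel (R : realType) (n : nat) (g : 'rV[R]_n -> 'M[R]_n)
    (k i j : 'I_n) (x : 'rV[R]_n) : R :=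
  2^-1 * \sum_(l < n) inv_metric g x k l *
    (partial i (fun y => g y j l) x + partial j (fun y => g y i l) x
     - partial l (fun y => g y i j) x).

(* R^l_{kij}, the components of
   R(d_i, d_j) d_k = nabla_i nabla_j d_k - nabla_j nabla_i d_k *)
Definition riemann (R : realType) (n : nat) (g : 'rV[R]_n -> 'M[R]_n)
    (l k i j : 'I_n) (x : 'rV[R]_n) : R :=
  partial i (christoffel g l j k) x - partial j (christoffel g l i k) x
  + \sum_(m < n) (christoffel g l i m x * christoffel g m j k x
                  - christoffel g l j m x * christoffel g m i k x).

(* R_{kj} = R^i_{kij}; with this contraction round spheres have positive
   Ricci curvature. *)
Definition ricci (R : realType) (n : nat) (g : 'rV[R]_n -> 'M[R]_n)
    (x : 'rV[R]_n) : 'M[R]_n :=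
  \matrix_(k, j) \sum_(i < n) riemann g i k i j x.

(* S = g^{ij} R_{ij} *)
Definition scalar_curvature (R : realType) (n : nat)
    (g : 'rV[R]_n -> 'M[R]_n) (x : 'rV[R]_n) : R :=
  \sum_(i < n) \sum_(j < n) inv_metric g x i j * ricci g x i j.

(* G_{ij} *)
Definition einstein (R : realType) (n : nat) (g : 'rV[R]_n -> 'M[R]_n)
    (x : 'rV[R]_n) : 'M[R]_n :=
  ricci g x - (2^-1 * scalar_curvature g x) *: g x.

(* T^{ij} = g^{ik} g^{jl} T_{kl} *)
Definition raise2 (R : realType) (n : nat) (g : 'rV[R]_n -> 'M[R]_n)
    (T : 'rV[R]_n -> 'M[R]_n) (x : 'rV[R]_n) : 'M[R]_n :=
  \matrix_(i, j) \sum_(k < n) \sum_(l < n)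
    inv_metric g x i k * inv_metric g x j l * T x k l.

(* p g^{ij} + (p + rho) u^i u^j *)
Definition perfect_fluid (R : realType) (n : nat) (g : 'rV[R]_n -> 'M[R]_n)
    (u : 'rV[R]_n -> 'rV[R]_n) (p rho : 'rV[R]_n -> R)
    (x : 'rV[R]_n) : 'M[R]_n :=
  \matrix_(i, j) (p x * inv_metric g x i j
                  + (p x + rho x) * (u x 0 i * u x 0 j)).

(* The coordinates are ordered (t, r, theta, phi); the metric below does not
   depend on phi. *)
Definition tc (R : realType) (x : 'rV[R]_4) : R := x 0 (@Ordinal 4 0 isT).
Definition rc (R : realType) (x : 'rV[R]_4) : R := x 0 (@Ordinal 4 1 isT).
Definition thetac (R : realType) (x : 'rV[R]_4) : R := x 0 (@Ordinal 4 2 isT).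

(* b r^2 dt^2 - 2 b r t dr dt + (a + b t^2) dr^2
   + r^2 (dtheta^2 + sin^2 theta dphi^2); the cross term dr dt is a symmetric
   product, hence contributes - b r t to each of g_{tr} and g_{rt}. *)
Definition metric (R : realType) (a b : R) (x : 'rV[R]_4) : 'M[R]_4 :=
  let t := tc x in let r := rc x in let theta := thetac x in
  \matrix_(i < 4, j < 4) nth 0 (nth [::]
    [:: [:: b * r ^+ 2   ; - (b * r * t)    ; 0      ; 0                        ];
        [:: - (b * r * t); a + b * t ^+ 2   ; 0      ; 0                        ];
        [:: 0            ; 0                ; r ^+ 2 ; 0                        ];
        [:: 0            ; 0                ; 0      ; r ^+ 2 * sin theta ^+ 2 ]]
    i) j.

(* u = (1 / (beta r), 0, 0, 0), contravariant components *)
Definition velocity (R : realType) (beta : R) (x : 'rV[R]_4) : 'rV[R]_4 :=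
  \row_(i < 4) nth 0 [:: 1 / (beta * rc x); 0; 0; 0] i.

(* Main.v *)
Require Import Defs.
From HB Require Import structures.
From mathcomp Require Import all_boot all_order all_algebra.
From mathcomp Require Import all_classical all_reals all_analysis.
From mathcomp Require Import ring.
Import Order.TTheory GRing.Theory Num.Theory.
Import numFieldNormedType.Exports.
Local Open Scope ring_scope.

Set Implicit Arguments.
Unset Strict Implicit.
Unset Printing Implicit Defensive.

(* Near the point, the metric and its Christoffel symbols are elementary
   expressions in the coordinates, so their partial derivatives come from a
   symbolic differentiation that is sound wherever no denominator vanishes;
   every tensor identity is then an identity of rational functions in t, r,
   sin theta and cos theta. In terms of tau = t/r the metric is
   dr^2 + b r^4 dtau^2 + r^2 dOmega^2, whose geodesic equations give the
   Christoffel symbols tabulated below. *)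

(** * Symbolic differentiation of coordinate expressions *)

Section Expressions.
Context {R : realType} {n : nat}.

Inductive expr : Type :=
| Cst of R
| Coord of 'I_n
| Opp of expr
| Add of expr & expr
| Mul of expr & expr
| Inv of expr
| Sin of expr
| Cos of expr.

Fixpoint eval (e : expr) (x : 'rV[R]_n) : R :=
  match e with
  | Cst c => c
  | Coord i => x 0 i
  | Opp e1 => - eval e1 x
  | Add e1 e2 => eval e1 x + eval e2 x
  | Mul e1 e2 => eval e1 x * eval e2 x
  | Inv e1 => (eval e1 x)^-1
  | Sin e1 => sin (eval e1 x)
  | Cos e1 => cos (eval e1 x)
  end.

Fixpoint diff_expr (k : 'I_n) (e : expr) : expr :=
  match e with
  | Cst _ => Cst 0
  | Coord i => Cst (if i == k :> nat then 1 else 0)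
  | Opp e1 => Opp (diff_expr k e1)
  | Add e1 e2 => Add (diff_expr k e1) (diff_expr k e2)
  | Mul e1 e2 => Add (Mul (diff_expr k e1) e2) (Mul e1 (diff_expr k e2))
  | Inv e1 => Opp (Mul (diff_expr k e1) (Inv (Mul e1 e1)))
  | Sin e1 => Mul (diff_expr k e1) (Cos e1)
  | Cos e1 => Opp (Mul (diff_expr k e1) (Sin e1))
  end.

(* No inverse is taken of 0, where the junk value 0^-1 = 0 would make [eval]
   discontinuous. *)
Fixpoint eval_defined (e : expr) (x : 'rV[R]_n) : Prop :=
  match e with
  | Cst _ | Coord _ => True
  | Opp e1 | Sin e1 | Cos e1 => eval_defined e1 x
  | Add e1 e2 | Mul e1 e2 => eval_defined e1 x /\ eval_defined e2 x
  | Inv e1 => eval_defined e1 x /\ eval e1 x != 0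
  end.

Lemma differentiable_real (f : R -> R) (y d : R) :
  is_derive y 1 f d -> differentiable f y.
Proof. by move=> fd; apply/derivable1_diffP; exact: ex_derive. Qed.

(** The differential of [h] at [f x] is linear on the real line, so its value at ['D_v f x] is that
    number times its value at 1, which is [d]. *)
Lemma derive_comp_real (f : 'rV[R]_n -> R) (h : R -> R) (x v : 'rV[R]_n)
    (d : R) :
  differentiable f x -> is_derive (f x) 1 h d ->
  'D_v (h \o f) x = 'D_v f x * d.
Proof.
move=> df dh; have dhf := differentiable_real dh.
rewrite deriveE; last exact: differentiable_comp.
rewrite diff_comp //= -(deriveE v df) -[in LHS](mulr1 ('D_v f x)).
by rewrite [LHS]linearZ /= -deriveE // derive_val.
Qed.

Lemma partial_coord (k i : 'I_n) (x : 'rV[R]_n) :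
  partial k (fun y => y 0 i) x = if i == k :> nat then 1 else 0.
Proof.
rewrite /partial deriveE; last exact: differentiable_coord.
(* Packaged as a continuous linear map, the coordinate function is its own differential. *)
have @f : {linear 'rV[R]_n -> R}.
  by exists (fun N : 'rV[R]_n => N 0 i); do 2![eexists]; do ?[constructor];
     rewrite ?mxE// => ? *; rewrite ?mxE//; move=> ?; rewrite !mxE.
rewrite (_ : (fun _ => _) = f) // diff_lin /=; last exact: coord_continuous.
by rewrite mxE eqxx /= -val_eqE /=; case: (_ == _).
Qed.

Lemma differentiable_eval (e : expr) (x : 'rV[R]_n) :
  eval_defined e x -> differentiable (eval e) x.
Proof.
elim: e => [c|i|e IH|e1 IH1 e2 IH2|e1 IH1 e2 IH2|e IH|e IH|e IH] /=.
- by move=> _; exact: differentiable_cst.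
- by move=> _; exact: differentiable_coord.
- by move=> /IH de; exact: differentiableN.
- by move=> [/IH1 d1 /IH2 d2]; exact: differentiableD.
- by move=> [/IH1 d1 /IH2 d2]; exact: differentiableM.
- by move=> [/IH de e0]; exact: differentiableV.
- move=> /IH de; apply: differentiable_comp => //.
  exact: differentiable_real (is_derive_sin _).
- move=> /IH de; apply: differentiable_comp => //.
  exact: differentiable_real (is_derive_cos _).
Qed.

Lemma partial_eval (k : 'I_n) (e : expr) (x : 'rV[R]_n) :
  eval_defined e x -> partial k (eval e) x = eval (diff_expr k e) x.
Proof.
have dv f y : differentiable f y -> derivable f y (delta_mx 0 k : 'rV[R]_n).
  exact: diff_derivable.
elim: e => [c|i|e IH|e1 IH1 e2 IH2|e1 IH1 e2 IH2|e IH|e IH|e IH] /=.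
- by move=> _; exact: derive_cst.
- by move=> _; exact: partial_coord.
- move=> de; rewrite -IH //; apply: deriveN; exact/dv/differentiable_eval.
- move=> [d1 d2]; rewrite -IH1 // -IH2 //.
  by apply: deriveD; exact/dv/differentiable_eval.
- move=> [d1 d2]; rewrite -IH1 // -IH2 // addrC [_ * eval e2 x]mulrC.
  by apply: deriveM; exact/dv/differentiable_eval.
- move=> [de e0]; rewrite -IH // mulrC -mulNr.
  by apply: deriveV => //; exact/dv/differentiable_eval.
- move=> de; rewrite -IH //.
  exact: derive_comp_real (differentiable_eval de) (is_derive_sin _).
- move=> de; rewrite -IH // -mulrN.
  exact: derive_comp_real (differentiable_eval de) (is_derive_cos _).
Qed.

End Expressions.
Arguments expr : clear implicits.
Arguments Cst {R n} _%_R.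

Declare Scope expr_scope.
Delimit Scope expr_scope with expr.
Notation "0" := (Cst 0) : expr_scope.
Notation "- e" := (Opp e) : expr_scope.
Notation "e1 + e2" := (Add e1 e2) : expr_scope.
Notation "e1 * e2" := (Mul e1 e2) : expr_scope.

(** * Indices and sums in dimension four *)

Section FourCoordinates.
Context {R : realType}.

Definition ordt : 'I_4 := @Ordinal 4 0 isT.
Definition ordr : 'I_4 := @Ordinal 4 1 isT.
Definition ordth : 'I_4 := @Ordinal 4 2 isT.
Definition ordph : 'I_4 := @Ordinal 4 3 isT.

(** Reduces a statement about an index to four closed ordinals, on which table lookups and index
    tests compute; proofs of the bound are irrelevant. *)
Lemma forall_ord4 (P : 'I_4 -> Prop) :
  P ordt -> P ordr -> P ordth -> P ordph -> forall i, P i.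
Proof.
move=> P0 P1 P2 P3 [[|[|[|[|i]]]] // Hi].
- by rewrite (_ : Ordinal Hi = ordt) //; exact: val_inj.
- by rewrite (_ : Ordinal Hi = ordr) //; exact: val_inj.
- by rewrite (_ : Ordinal Hi = ordth) //; exact: val_inj.
- by rewrite (_ : Ordinal Hi = ordph) //; exact: val_inj.
Qed.

Lemma sum_ord4 (F : 'I_4 -> R) :
  \sum_(i < 4) F i = F ordt + F ordr + F ordth + F ordph.
Proof.
rewrite !big_ord_recl big_ord0 addr0 !addrA.
by congr (F _ + F _ + F _ + F _); exact: val_inj.
Qed.

End FourCoordinates.

(** * Inverse metric, connection and curvature for a = 1 *)

Section Metric.
Context {R : realType}.
Variable b : R.
Hypothesis b0 : b != 0.

Local Notation T := (Coord ordt).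
Local Notation Rr := (Coord ordr).
Local Notation Th := (Coord ordth).

Definition metric_expr (i j : 'I_4) : expr R 4 := (nth 0 (nth [::]
  [:: [:: Cst b * (Rr * Rr); - (Cst b * Rr * T); 0; 0];
      [:: - (Cst b * Rr * T); Cst 1 + Cst b * (T * T); 0; 0];
      [:: 0; 0; Rr * Rr; 0];
      [:: 0; 0; 0; Rr * Rr * (Sin Th * Sin Th)]] i) j)%expr.

Lemma metricE (x : 'rV[R]_4) (i j : 'I_4) :
  metric 1 b x i j = eval (metric_expr i j) x.
Proof.
by rewrite mxE; move: i j; do 2!apply: forall_ord4; rewrite /= ?expr2.
Qed.

Lemma partial_metric (k i j : 'I_4) (x : 'rV[R]_4) :
  partial k (fun y => metric 1 b y i j) x =
    eval (diff_expr k (metric_expr i j)) x.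
Proof.
rewrite -partial_eval; last first.
  by move: i j; do 2!apply: forall_ord4; rewrite /=; tauto.
by congr (partial k _ x); apply/funext => y; exact: metricE.
Qed.

(** The determinant of the metric is b r^6 sin^2 theta; as b is nonzero, these are exactly the
    points where the metric is nondegenerate. *)
Definition regular (x : 'rV[R]_4) := rc x != 0 /\ sin (thetac x) != 0.

Definition inv_entries (x : 'rV[R]_4) (i j : 'I_4) : R :=
  let t := tc x in let r := rc x in let s := sin (thetac x) in
  nth 0 (nth [::]
  [:: [:: (1 + b * t ^+ 2) / (b * r ^+ 2); t / r; 0; 0];
      [:: t / r; 1; 0; 0];
      [:: 0; 0; r ^- 2; 0];
      [:: 0; 0; 0; (r * s) ^- 2]] i) j.

Lemma inv_metricE (x : 'rV[R]_4) (i j : 'I_4) :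
  regular x -> inv_metric (metric 1 b) x i j = inv_entries x i j.
Proof.
move=> [r0 s0]; rewrite /inv_metric.
(* A right inverse of a square matrix is its inverse, so one product of tables is enough. *)
have mulV : metric 1 b x *m (\matrix_(i, j) inv_entries x i j) = 1%:M.
  apply/matrixP => {}i {}j; rewrite !mxE sum_ord4 !mxE.
  by move: i j; do 2!apply: forall_ord4; rewrite /inv_entries /= -?val_eqE /=;
    field; rewrite ?r0 ?s0 ?b0.
have [gU _] := mulmx1_unit mulV.
by rewrite -[invmx _]mulmx1 -mulV mulKmx // mxE.
Qed.

(** The outermost table index is the upper one. The symbols are expressions rather than real values
    because the curvature differentiates them again. *)
Definition christoffel_expr (k i j : 'I_4) : expr R 4 := (nth 0
  (nth [::] (nth [::]
  [:: [:: [:: Cst (- 2) * Cst b * T;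
              Cst 2 * Cst b * (T * T) * Inv Rr + Inv Rr; 0; 0];
          [:: Cst 2 * Cst b * (T * T) * Inv Rr + Inv Rr;
              Cst (- 2) * T * (Cst b * (T * T) + Cst 1)
                * Inv (Rr * Rr); 0; 0];
          [:: 0; 0; - T; 0];
          [:: 0; 0; 0; - (T * (Sin Th * Sin Th))]];
      [:: [:: Cst (- 2) * Cst b * Rr; Cst 2 * Cst b * T; 0; 0];
          [:: Cst 2 * Cst b * T;
              Cst (- 2) * Cst b * (T * T) * Inv Rr; 0; 0];
          [:: 0; 0; - Rr; 0];
          [:: 0; 0; 0; - (Rr * (Sin Th * Sin Th))]];
      [:: [:: 0; 0; 0; 0];
          [:: 0; 0; Inv Rr; 0];
          [:: 0; Inv Rr; 0; 0];
          [:: 0; 0; 0; - (Sin Th * Cos Th)]];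
      [:: [:: 0; 0; 0; 0];
          [:: 0; 0; 0; Inv Rr];
          [:: 0; 0; 0; Cos Th * Inv (Sin Th)];
          [:: 0; Inv Rr; Cos Th * Inv (Sin Th); 0]]]
  k) i) j)%expr.

Lemma christoffelE (x : 'rV[R]_4) (k i j : 'I_4) :
  regular x ->
  christoffel (metric 1 b) k i j x = eval (christoffel_expr k i j) x.
Proof.
move=> xreg; have [r0 s0] := xreg.
rewrite /christoffel sum_ord4 !partial_metric !inv_metricE //.
(* Both sides must mention the same atoms [x 0 ordt], [x 0 ordr], [x 0 ordth] for [field]. *)
move: r0 s0; rewrite /inv_entries /rc /tc /thetac -!/ordr -!/ordt -!/ordth.
move: k i j; do 3!apply: forall_ord4; move=> r0 s0 /=.
all: by field; rewrite ?r0 ?s0 ?b0.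
Qed.

(** Regularity is the nonvanishing of two continuous functions, hence an open condition. *)
Lemma near_regular (x : 'rV[R]_4) :
  regular x -> \forall y \near x, regular y.
Proof.
move=> [r0 s0]; near=> y; split; near: y.
- have cr : {for x, continuous (@rc R)} by exact: coord_continuous.
  exact: (cr _ (open_nbhs_nbhs (conj (@open_neq _ 0) r0))).
- have cr : {for x, continuous (sin \o @thetac R)}.
    apply: continuous_comp; first exact: coord_continuous.
    exact: continuous_sin.
  exact: (cr _ (open_nbhs_nbhs (conj (@open_neq _ 0) s0))).
Unshelve. all: by end_near. Qed.

Lemma partial_christoffel (x : 'rV[R]_4) (l k i j : 'I_4) :
  regular x -> partial l (christoffel (metric 1 b) k i j) x =
    eval (diff_expr l (christoffel_expr k i j)) x.
Proof.
move=> xreg; have [r0 s0] := xreg.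
rewrite -partial_eval; last first.
  move: r0 s0; rewrite /rc /thetac -/ordr -/ordth.
  by move: k i j; do 3!apply: forall_ord4; move=> r0 s0 /=;
    do ?split; rewrite ?mulf_neq0.
(* A derivative depends only on the germ, and the tabulated formula holds on a whole
   neighbourhood. *)
apply: near_eq_derive.
by near do apply: christoffelE; exact: near_regular.
Unshelve. all: by end_near. Qed.

(** With tau = t/r this is -2/r^2 (g + 2 b r^4 dtau^2). Relative to g its eigenvalues are -6/r^2
    once and -2/r^2 three times, whence the scalar curvature -12/r^2. *)
Definition ricci_entries (x : 'rV[R]_4) (i j : 'I_4) : R :=
  let t := tc x in let r := rc x in
  nth 0 (nth [::]
  [:: [:: - 6 * b; 6 * b * t / r; 0; 0];
      [:: 6 * b * t / r; - (2 + 6 * b * t ^+ 2) / r ^+ 2; 0; 0];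
      [:: 0; 0; - 2; 0];
      [:: 0; 0; 0; - 2 * sin (thetac x) ^+ 2]] i) j.

Lemma ricciE (x : 'rV[R]_4) (i j : 'I_4) :
  regular x -> ricci (metric 1 b) x i j = ricci_entries x i j.
Proof.
move=> xreg; have [r0 s0] := xreg.
rewrite mxE sum_ord4 /riemann !sum_ord4 !partial_christoffel //.
rewrite !christoffelE //.
(* The relation between the atoms sin theta and cos theta is handed to [field]. *)
have := cos2Dsin2 (x 0 ordth).
move: r0 s0; rewrite /ricci_entries /rc /tc /thetac -!/ordr -!/ordt -!/ordth.
move: i j; do 2!apply: forall_ord4; move=> r0 s0 cs /=.
all: by field: cs; rewrite ?r0 ?s0 ?b0.
Qed.

Lemma scalar_curvatureE (x : 'rV[R]_4) :
  regular x -> scalar_curvature (metric 1 b) x = - 12 / rc x ^+ 2.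
Proof.
move=> xreg; have [r0 s0] := xreg.
rewrite /scalar_curvature !sum_ord4 !inv_metricE // !ricciE //.
rewrite /inv_entries /ricci_entries /=.
by field; rewrite ?r0 ?s0 ?b0.
Qed.

Lemma einsteinE (x : 'rV[R]_4) (i j : 'I_4) :
  regular x -> einstein (metric 1 b) x i j =
    ricci_entries x i j + 6 / rc x ^+ 2 * eval (metric_expr i j) x.
Proof.
move=> xreg; have [r0 _] := xreg.
rewrite /einstein mxE [X in _ + X]mxE [X in _ - X]mxE ricciE // metricE.
by rewrite scalar_curvatureE //; congr (_ + _); field.
Qed.

(** Adding 6/r^2 g to the Ricci tensor gives 4/r^2 (g - b r^4 dtau^2). Raising the index of dtau
    gives 1/(b r^3) d/dt, so the second term contributes only to the tt entry. *)
Lemma raised_einsteinE (x : 'rV[R]_4) (i j : 'I_4) :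
  regular x ->
  raise2 (metric 1 b) (einstein (metric 1 b)) x i j =
    4 / rc x ^+ 2 * inv_metric (metric 1 b) x i j
    - (if (i == ordt) && (j == ordt) then 4 / (b * rc x ^+ 4) else 0).
Proof.
move=> xreg; have [r0 s0] := xreg.
rewrite mxE !sum_ord4 !inv_metricE // !einsteinE //.
rewrite /inv_entries /ricci_entries.
move: r0 s0; rewrite /rc /tc /thetac -!/ordr -!/ordt -!/ordth => r0 s0.
move: i j; do 2!apply: forall_ord4; rewrite -?val_eqE /=.
all: by field; rewrite ?r0 ?s0 ?b0.
Qed.

End Metric.

(** * Comparison with the perfect fluid *)

Lemma velocityE (R : realType) (beta : R) (x : 'rV[R]_4) (i : 'I_4) :
  velocity beta x 0 i = if i == ordt then 1 / (beta * rc x) else 0.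
Proof. by rewrite mxE; move: i; apply: forall_ord4. Qed.

Theorem mainTheorem4 (R : realType) (G_N a b beta : R)
  (hG : 0 < G_N) (ha : a = 1) (hb : b = - beta ^+ 2) (hbeta : beta != 0) :
  let g := metric a b in
  let u := velocity beta in
  let p := fun y : 'rV[R]_4 => 1 / (2 * pi * G_N * rc y ^+ 2) in
  let rho := fun _ : 'rV[R]_4 => 0 in
  forall x : 'rV[R]_4, 0 < rc x -> 0 < thetac x -> thetac x < pi ->
  [/\ \sum_(i < 4) \sum_(j < 4) g x i j * u x 0 i * u x 0 j = -1,
      forall i j : 'I_4,
        raise2 g (einstein g) x i j =
          4 / rc x ^+ 2 * inv_metric g x i j
          + 4 / rc x ^+ 2 * (u x 0 i * u x 0 j)
    & forall i j : 'I_4,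
        raise2 g (einstein g) x i j =
          8 * pi * G_N * perfect_fluid g u p rho x i j].
Proof.
move=> g u p rho x r_gt0 th_gt0 th_ltpi.
have r0 : rc x != 0 by rewrite gt_eqF.
have xreg : regular x by split; rewrite // gt_eqF // sin_gt0_pi // th_gt0.
have b0 : b != 0 by rewrite hb oppr_eq0 expf_neq0.
have einstein_up (i j : 'I_4) : raise2 g (einstein g) x i j =
    4 / rc x ^+ 2 * inv_metric g x i j + 4 / rc x ^+ 2 * (u x 0 i * u x 0 j).
  (* With b = -beta^2 the tt correction -4/(b r^4) becomes 4/r^2 times the square of 1/(beta r). *)
  rewrite /g ha raised_einsteinE // !velocityE hb; congr (_ + _).
  by case: (i == ordt); case: (j == ordt) => /=; field; rewrite ?r0 ?hbeta.
split=> // [|i j].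
- rewrite !sum_ord4 !velocityE /g ha hb !mxE /=.
  by field; rewrite r0 hbeta.
(* Since 8 pi G_N p = 4/r^2 and rho = 0, both fluid coefficients become 4/r^2. *)
- rewrite einstein_up [X in _ = _ * X]mxE /p /rho.
  have pi0 : pi != 0 :> R by rewrite gt_eqF // pi_gt0.
  have G0 : G_N != 0 by rewrite gt_eqF.
  (* [field] would unfold [pi] *)
  move: (@pi R) pi0 => c c0.
  by field; rewrite r0 c0 G0.
Qed.
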